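(* If $\mathcal{C}=L$ or $\mathcal{C}=L_{0\ast}$, then $\mathbf{I}(\mathcal{C})$ is a two-element chain (with respect to inclusion): $\mathbf{I}(\mathcal{C})=\{\mathcal{C},\mathcal{C}_{=}\}$.
   Context: $\Omega$ is the set of all Boolean functions $f\colon\{0,1\}^n\to\{0,1\}$, $n\ge 1$. An $m$-ary $g$ is a subfunction of an $n$-ary $f$ if there is a map $\sigma\colon\{1,\dots,n\}\to\{1,\dots,m\}$ with $g(x_1,\dots,x_m)=f(x_{\sigma(1)},\dots,x_{\sigma(n)})$ identically. An equational class is a set $\mathcal{K}\subseteq\Omega$ (possibly empty) such that every subfunction of a member of $\mathcal{K}$ is in $\mathcal{K}$. For an $n$-ary $f$ and $k$-ary $g_1,\dots,g_n$, the composition $f(g_1,\dots,g_n)$ is the $k$-ary function $\mathbf{a}\mapsto f(g_1(\mathbf{a}),\dots,g_n(\mathbf{a}))$; $\mathcal{K}$ is composition-closed if all compositions $f(g_1,\dots,g_n)$ with $f,g_1,\dots,g_n\in\mathcal{K}$ ($g_i$ of equal arity) belong to $\mathcal{K}$. A clone is a composition-closed subset of $\Omega$ containing all projections; $[\mathcal{K}]$ is the smallest clone containing $\mathcal{K}$. $\mathbf{I}$ is the set of all composition-closed equational classes, and $\mathbf{I}(\mathcal{C})=\{\mathcal{K}\in\mathbf{I}:[\mathcal{K}]=\mathcal{C}\}$. $L$ is the clone of linear functions, i.e. functions that are a sum modulo $2$ of some (possibly zero) of their variables plus a constant $c\in\{0,1\}$ (inessential variables are allowed). $L_{0\ast}=\{f\in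 L:f(0,\dots,0)=0\}$. $\Omega_{=}=\{f\in\Omega:f(0,\dots,0)=f(1,\dots,1)\}$ and $\mathcal{C}_{=}=\mathcal{C}\cap\Omega_{=}$. *)

(* Defs.v *)
From mathcomp Require Import all_boot.
From mathcomp Require Import boolp classical_sets.

Set Implicit Arguments.
Unset Strict Implicit.
Unset Printing Implicit Defensive.

Local Open Scope classical_set_scope.

Definition bfun (n : nat) := {ffun bool ^ n -> bool}.

(* The tag of a function is the predecessor of its arity, so that all arities
   are positive. *)
Definition Omega := {n : nat & bfun n.+1}.

Definition omega n (f : bfun n.+1) : Omega := Tagged (fun n => bfun n.+1) f.

Definition arity (f : Omega) : nat := (tag f).+1.

Definition fn (f : Omega) : bfun (arity f) := tagged f.

Definition subfunction (g f : Omega) : Prop :=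
  exists s : 'I_(arity f) -> 'I_(arity g),
    forall x : bool ^ arity g, fn g x = fn f [ffun i => x (s i)].

Definition equational_class (K : set Omega) : Prop :=
  forall f g : Omega, K f -> subfunction g f -> K g.

Definition bcomp n k (f : bfun n) (g : 'I_n -> bfun k) : bfun k :=
  [ffun a => f [ffun i => g i a]].

Definition comp_closed (K : set Omega) : Prop :=
  forall (n k : nat) (f : bfun n.+1) (g : 'I_n.+1 -> bfun k.+1),
    K (omega f) -> (forall i, K (omega (g i))) -> K (omega (bcomp f g)).

Definition bproj n (i : 'I_n) : bfun n := [ffun x : bool ^ n => x i].

Definition clone (K : set Omega) : Prop :=
  comp_closed K /\ forall (n : nat) (i : 'I_n.+1), K (omega (bproj i)).

Definition clone_gen (K : set Omega) : set Omega := smallest clone K.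

Definition I_all : set (set Omega) :=
  [set K | equational_class K /\ comp_closed K].

Definition I_of (C : set Omega) : set (set Omega) :=
  [set K | I_all K /\ clone_gen K = C].

Definition L : set Omega :=
  [set f | exists (A : {set 'I_(arity f)}) (c : bool),
     forall x : bool ^ arity f, fn f x = (\big[addb/false]_(i in A) x i) (+) c].

Definition L0 : set Omega := L `&` [set f | fn f [ffun=> false] = false].

Definition Omega_eq : set Omega :=
  [set f | fn f [ffun=> false] = fn f [ffun=> true]].

(* Main.v *)
Require Import Defs.
From mathcomp Require Import all_boot.
From mathcomp Require Import boolp classical_sets.

Set Implicit Arguments.
Unset Strict Implicit.
Unset Printing Implicit Defensive.

(** Both [L] and [L0] are clones of linear functions containing the binary sum
[xor2 false].  The classification holds for every such clone [C]
([I_of_linear_clone]).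

The class [C `&` Omega_eq] generates [C]: a function [f] of [C] outside
[Omega_eq] becomes a member of [Omega_eq] after adding its first variable, and
adding that variable again restores [f]; the binary sum is in [Omega_eq] too
([clone_gen_Omega_eq]).

Conversely let [K] be a composition-closed equational class generating [C].

If [K] has a member with different values at the two constant tuples, then
identifying all its variables yields the identity or the negation; as the
negation composed with itself is the identity, [K] contains all projections.
So [K] is already a clone, that is, [K] is [C] ([clone_of_not_Omega_eq]).

Otherwise [K] is contained in [C `&` Omega_eq].  A class all of whose members
preserve a relation generates a clone whose members preserve it too, while the
binary sum is not monotone and does not preserve the value 1.  So [K] has a
nonconstant member, in which identification of variables leaves [x + y + c],
and it has a constant 0; from these one composes [x + y] ([xor2_in]).  Hence [K]
is closed under sums, and it contains every even sum of variables because such a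
sum over [A] is the sum of the functions [x_i + x_0] with [i] in [A].  The
constant 1 is in [K] as soon as [C] has a member that takes the value 1 at the
zero tuple, again because otherwise all of [C] would preserve 0.  This gives all
of [C `&` Omega_eq] ([clone_gen_Omega_eq_sub]). *)

Local Open Scope classical_set_scope.

(** * Linear functions form a clone *)

Lemma linear_sumE n (A : {set 'I_n}) (x : bool ^ n) :
  \big[addb/false]_(i in A) x i = \big[addb/false]_i ((i \in A) && x i).
Proof. by rewrite big_mkcond; apply: eq_bigr => i _; case: (i \in A). Qed.

Lemma L_omegaP n (f : bfun n.+1) :
  L (omega f) <-> exists (A : {set 'I_n.+1}) (c : bool),
    forall x, f x = (\big[addb/false]_(i in A) x i) (+) c.
Proof. by []. Qed.

(** Substituting linear functions into a linear one and exchanging the two sums,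
[x_j] survives exactly when it occurs in an odd number of the inner sums; the
coefficient set and the constant of the composition are read off from this. *)
Lemma L_comp_closed : comp_closed L.
Proof.
move=> n k f g /L_omegaP [A [c fE]] Lg.
have [B BE] := choice (fun i => (L_omegaP (g i)).1 (Lg i)).
have [d dE] := choice BE.
apply/L_omegaP; exists [set j | \big[addb/false]_(i in A) (j \in B i)]%SET.
exists ((\big[addb/false]_(i in A) d i) (+) c) => x.
rewrite ffunE fE addbA; congr (_ (+) _).
under eq_bigr => i _ do rewrite ffunE dE linear_sumE.
rewrite big_split; congr (_ (+) _).
rewrite exchange_big linear_sumE; apply: eq_bigr => j _.
by rewrite inE big_distrl.
Qed.

Lemma L_clone : clone L.
Proof.
split; first exact: L_comp_closed.
move=> n i; apply/L_omegaP; exists [set i]%SET, false => x.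
by rewrite big_set1 addbF ffunE.
Qed.

Lemma L0_clone : clone L0.
Proof.
have [Lc Lp] := L_clone; split=> [n k f g [Lf f0] Kg|n i].
  split; first by apply: Lc => // i; have [] := Kg i.
  rewrite /= ffunE -[RHS]f0 /=; congr (f _); apply/ffunP => i.
  by rewrite !ffunE; have [_] := Kg i.
by split; [exact: Lp | rewrite /= !ffunE].
Qed.

(** * Sums inside a composition-closed class *)

(** The constant [c] is carried along because the two functions [x + y] and
[x + y + 1] arise side by side when variables of a linear function are
identified. *)
Definition addf c n (f g : bfun n) : bfun n := [ffun x => f x (+) g x (+) c].

Definition xor2 c : bfun 2 := addf c (bproj ord0) (bproj ord_max).

Definition cstf n (c : bool) : bfun n := [ffun=> c].

Lemma L0_xor2 : L0 (omega (xor2 false)).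
Proof.
split; last by rewrite /= !ffunE.
apply/L_omegaP; exists [set: 'I_2]%SET, false => x.
rewrite linear_sumE big_ord_recl big_ord1 !inE !addbF !ffunE addbF.
by congr (_ (+) x _); apply: val_inj.
Qed.

Lemma Omega_eq_xor2 : Omega_eq (omega (xor2 false)).
Proof. by rewrite /Omega_eq /= !ffunE. Qed.

Lemma comp_closed_addf K c n (f g : bfun n.+1) :
    comp_closed K -> K (omega (xor2 c)) -> K (omega f) -> K (omega g) ->
  K (omega (addf c f g)).
Proof.
move=> Kc Kh Kf Kg.
suff -> : addf c f g = bcomp (xor2 c) (fun i => if i == ord0 then f else g).
  by apply: Kc => // i; case: ifP.
by apply/ffunP => x; rewrite !ffunE.
Qed.

Lemma comp_closed_sum K n (I : finType) (A : {set I}) (F : I -> bfun n.+1) :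
    comp_closed K -> K (omega (xor2 false)) -> K (omega (cstf n.+1 false)) ->
    (forall i, K (omega (F i))) ->
  K (omega [ffun x => \big[addb/false]_(i in A) F i x]).
Proof.
move=> Kc Kx K0 KF; elim: (index_enum I) => [|i r IHr].
  by move: K0; congr (K (omega _)); apply/ffunP => x; rewrite !ffunE big_nil.
have [iA|iA] := boolP (i \in A); last first.
  move: IHr; congr (K (omega _)).
  by apply/ffunP => x; rewrite !ffunE big_cons (negbTE iA).
have := comp_closed_addf Kc Kx (KF i) IHr; congr (K (omega _)).
by apply/ffunP => x; rewrite !ffunE big_cons iA addbF.
Qed.

(** * Generated clones and preserved relations *)

Definition preserves (r : rel bool) : set Omega :=
  [set f | forall x y : bool ^ arity f,
             (forall i, r (x i) (y i)) -> r (fn f x) (fn f y)].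

Lemma preserves_clone r : clone (preserves r).
Proof.
split=> [n k f g rf rg x y rxy|n i x y rxy] /=; rewrite !ffunE //.
by apply: rf => i; rewrite !ffunE; apply: rg.
Qed.

(** Read contrapositively, this is the source of members of [K] with prescribed
behaviour: if [clone_gen K] has a member that breaks a relation, so has [K]. *)
Lemma clone_gen_preserves K r :
  K `<=` preserves r -> clone_gen K `<=` preserves r.
Proof. by move=> Kr; apply: smallest_sub Kr; exact: preserves_clone. Qed.

Lemma clone_gen_id C : clone C -> clone_gen C = C.
Proof.
move=> Cc; apply/seteqP; split; first exact: smallest_sub.
exact: sub_gen_smallest.
Qed.

(** * [C] and [C `&` Omega_eq] are classes generating [C] *)

Lemma clone_equational C : clone C -> equational_class C.
Proof.
move=> [Cc Cp] [n f] [m g] Cf [s gE].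
suff -> : existT _ m g = omega (bcomp f (fun i => bproj (s i))) by exact: Cc.
congr (existT _ m _); apply/ffunP => x; rewrite [LHS]gE !ffunE /=.
by congr (f _); apply/ffunP => i; rewrite !ffunE.
Qed.

Lemma Omega_eq_equational : equational_class Omega_eq.
Proof.
move=> f g fe [s gE]; rewrite /Omega_eq /= !gE.
have E c : [ffun i => [ffun=> c] (s i)] = [ffun=> c] :> bool ^ arity f.
  by apply/ffunP => i; rewrite !ffunE.
by rewrite !E.
Qed.

(** Inner functions in [Omega_eq] send the two constant tuples to the same
tuple, so any outer function takes the same value there. *)
Lemma Omega_eq_comp n k (f : bfun n.+1) (g : 'I_n.+1 -> bfun k.+1) :
  (forall i, Omega_eq (omega (g i))) -> Omega_eq (omega (bcomp f g)).
Proof.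
move=> ge; rewrite /Omega_eq /= !ffunE; congr (f _).
by apply/ffunP => i; rewrite !ffunE; exact: (ge i).
Qed.

Lemma I_all_clone C : clone C -> I_all C.
Proof. by move=> Cc; split; [exact: clone_equational | case: Cc]. Qed.

Lemma I_all_Omega_eq C : clone C -> I_all (C `&` Omega_eq).
Proof.
move=> Cc; split=> [f g [Cf fe] gf|n k f g [Cf _] Cg].
  split; first exact: (clone_equational Cc Cf).
  exact: (Omega_eq_equational fe).
split; first by apply: Cc.1 => // i; case: (Cg i).
by apply: Omega_eq_comp => i; case: (Cg i).
Qed.

Lemma clone_gen_Omega_eq C :
  clone C -> C (omega (xor2 false)) -> clone_gen (C `&` Omega_eq) = C.
Proof.
move=> Cc Cx; apply/seteqP; split.
  by apply: smallest_sub => // f [].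
move=> [n f] Cf M [[Mc Mp] CM].
have [fe|fne] := pselect (Omega_eq (omega f)); first exact: CM.
pose p : bfun n.+1 := bproj ord0.
have Mfp : M (omega (addf false f p)).
  apply: CM; split; first exact: comp_closed_addf Cc.1 Cx Cf (Cc.2 _ _).
  move: fne; rewrite /Omega_eq /= !ffunE.
  by case: (f _); case: (f _).
have Mx : M (omega (xor2 false)) by apply: CM; split=> //; exact: Omega_eq_xor2.
have := comp_closed_addf Mc Mx Mfp (Mp n ord0); congr (M (existT _ n _)).
by apply/ffunP => x; rewrite !ffunE !addbF addbK.
Qed.

(** * Classes not contained in [Omega_eq] *)

(** Identifying all variables of a function with different values at the two
constant tuples gives a nonconstant unary function, whose square is the identity;
a single unary projection yields all projections by adding variables. *)
Lemma clone_of_not_Omega_eq K f :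
  I_all K -> K f -> ~ Omega_eq f -> clone K.
Proof.
move=> [Ke Kc] Kf fne; split=> // n i.
pose u : bfun 1 := [ffun x : bool ^ 1 => fn f [ffun=> x ord0]].
have Ku : K (omega u).
  apply: Ke Kf _; exists (fun=> ord0) => x; rewrite /= ffunE.
  by congr (fn f _); apply/ffunP => j; rewrite !ffunE.
apply: Ke (Kc _ _ _ (fun=> u) Ku (fun=> Ku)) _.
exists (fun=> i) => x; rewrite /= !ffunE.
move: fne; rewrite /Omega_eq /=.
by case: (x i); case E0: (fn f [ffun=> false]); case E1: (fn f [ffun=> true]).
Qed.

(** * Classes contained in [Omega_eq] *)

Lemma cstf_in K f n :
    equational_class K -> K `<=` Omega_eq -> K f ->
  K (omega (cstf n.+1 (fn f [ffun=> false]))).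
Proof.
move=> Ke Keq Kf; apply: Ke (Kf) _; exists (fun=> ord0) => x; rewrite /= ffunE.
have -> : [ffun i => x ((fun=> ord0) i)] = [ffun=> x ord0] :> bool ^ arity f.
  by apply/ffunP => i; rewrite !ffunE.
by case: (x ord0) => //; exact: Keq.
Qed.

(** Keep one variable [x_i] occurring in [f] and identify all the others: as [f]
takes the same value [c] at the constant tuples and flips with [x_i], the result
is [x + y + c]. *)
Lemma linear_nonconstant_xor2 K n (f : bfun n.+1) (x y : bool ^ n.+1) :
    equational_class K -> K (omega f) -> L (omega f) -> Omega_eq (omega f) ->
  f x != f y -> K (omega (xor2 (f [ffun=> false]))).
Proof.
move=> Ke Kf /L_omegaP [A [c fE]] fe fxy.
have [i iA] : exists i, i \in A.
  apply/set0Pn; apply: contraNneq fxy => A0.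
  by rewrite !fE A0 !big_set0.
apply: Ke Kf _.
exists (fun j => if j == i then ord0 else ord_max) => z; rewrite /= !ffunE.
have flip (b d : bool) :
    f [ffun j => if j == i then b else d] = b (+) d (+) f [ffun=> d].
  rewrite !fE (bigD1 i iA) [X in _ = _ (+) (X (+) _)](bigD1 i iA) /= !ffunE eqxx.
  under eq_bigr => j /andP[_ /negPf ji] do rewrite ffunE ji.
  under [in RHS]eq_bigr => j _ do rewrite ffunE.
  by case: b; case: d; case: (c); case: (\big[_/_]_(_ | _) _).
have -> : [ffun j => z (if j == i then ord0 else ord_max)] =
          [ffun j => if j == i then z ord0 else z ord_max] :> bool ^ n.+1.
  by apply/ffunP => j; rewrite !ffunE; case: ifP.
rewrite flip; congr (_ (+) _).
by case: (z ord_max) => //; exact: fe.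
Qed.

Lemma cstf0_in K n :
    equational_class K -> K `<=` Omega_eq ->
    clone_gen K (omega (xor2 false)) ->
  K (omega (cstf n.+1 false)).
Proof.
move=> Ke Keq Kx.
have [f Kf f0] : exists2 f, K f & fn f [ffun=> false] = false.
  apply: contrapT => no0.
  (* Otherwise [K] preserves the relation holding only of two ones, but the
     binary sum of two ones is zero. *)
  have : K `<=` preserves andb.
    move=> f Kf x y xy.
    have E (z : bool ^ arity f) : (forall i, z i) -> fn f z.
      move=> z1; have -> : z = [ffun=> true].
        by apply/ffunP => i; rewrite ffunE z1.
      rewrite -Keq //; apply: contrapT => /negP/negbTE f0.
      by apply: no0; exists f.
    by apply/andP; split; apply: E => i; have /andP[] := xy i.
  move=> /clone_gen_preserves /(_ _ Kx [ffun=> true] [ffun=> true]).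
  by rewrite /= !ffunE => /(_ _)/notF; apply=> i; rewrite ffunE.
by rewrite -f0; exact: cstf_in.
Qed.

(** Failure of monotonicity gives [K] a nonconstant member, hence [x + y + c];
the constant 0 turns [x + y + 1] into [x + y]. *)
Lemma xor2_in K :
    I_all K -> K `<=` L -> K `<=` Omega_eq ->
    clone_gen K (omega (xor2 false)) ->
  K (omega (xor2 false)).
Proof.
move=> [Ke Kc] KL Keq Kx.
have [c Kxc] : exists c, K (omega (xor2 c)).
  apply: contrapT => nox.
  have : K `<=` preserves implb.
    move=> [n f] Kf x y _ /=.
    have [->|fxy] := eqVneq (f x) (f y); first by case: (f y).
    exfalso; apply: nox; exists (f [ffun=> false]).
    exact: linear_nonconstant_xor2 Ke Kf (KL _ Kf) (Keq _ Kf) fxy.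
  move=> /clone_gen_preserves.
  move=> /(_ _ Kx [ffun i => i == ord0] [ffun=> true]).
  by rewrite /= !ffunE => /(_ _)/notF; apply=> i; rewrite !ffunE implybT.
case: c Kxc => // Kx1.
(* Substitute in [x + y + 1]: (x + y + 1) + 0 + 1 = x + y. *)
have := comp_closed_addf Kc Kx1 Kx1 (cstf0_in 1 Ke Keq Kx).
congr (K (omega _)); apply/ffunP => x; rewrite !ffunE.
by case: (x _); case: (x _).
Qed.

(** An even sum over [A] is the sum of the binary sums [x_i + x_0] for [i] in [A],
since [x_0] is then added an even number of times. *)
Lemma clone_gen_Omega_eq_sub K :
    I_all K -> K `<=` L -> K `<=` Omega_eq ->
    clone_gen K (omega (xor2 false)) ->
  clone_gen K `&` Omega_eq `<=` K.
Proof.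
move=> KI KL Keq Kx [n f] [Cf fe].
have /L_omegaP [A [c fE]] := smallest_sub L_clone KL Cf.
have Kx2 := xor2_in KI KL Keq Kx; have [Ke Kc] := KI.
have K0 := cstf0_in n Ke Keq Kx.
have Kcst : K (omega (cstf n.+1 c)).
  case: c fE => // fE.
  have [g Kg g1] : exists2 g, K g & fn g [ffun=> false] = true.
    apply: contrapT => no1.
    (* Otherwise [K] preserves the relation holding only of two zeros, but [f]
       takes the value 1 at the zero tuple. *)
    have : K `<=` preserves (fun a b => ~~ (a || b)).
      move=> g Kg x y xy.
      have E (z : bool ^ arity g) : (forall i, ~~ z i) -> fn g z = false.
        move=> z0; have -> : z = [ffun=> false].
          by apply/ffunP => i; rewrite ffunE; apply/negbTE.
        by apply/negbTE/negP => g1; apply: no1; exists g.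
      by rewrite !E // => i; have := xy i; rewrite negb_or => /andP[].
    move=> /clone_gen_preserves /(_ _ Cf [ffun=> false] [ffun=> false]).
    rewrite /= !fE big1 => [|i _]; last by rewrite ffunE.
    by move=> /(_ _)/notF; apply=> i; rewrite ffunE.
  by rewrite -g1; exact: cstf_in.
have Kpair (i : 'I_n.+1) : K (omega (addf false (bproj i) (bproj ord0))).
  apply: Ke Kx2 _; exists (fun j => if j == ord0 then i else ord0) => x.
  by rewrite /= !ffunE.
have Ksum := comp_closed_sum A Kc Kx2 K0 Kpair.
have := comp_closed_addf Kc Kx2 Ksum Kcst.
congr (K (existT _ n _)); apply/ffunP => x; rewrite !ffunE fE addbF.
congr (_ (+) _).
under eq_bigr => i _ do rewrite !ffunE addbF.
rewrite big_split /=.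
have -> : \big[addb/false]_(i in A) x ord0 = false.
  (* Comparing [f] at the two constant tuples shows that [A] is even. *)
  case: (x ord0); last by rewrite big1.
  move: fe; rewrite /Omega_eq /= !fE [in LHS]big1 => [|i _]; last first.
    by rewrite ffunE.
  under eq_bigr => i _ do rewrite ffunE.
  by case: (c); case: (\big[_/_]_(_ in _) _).
by rewrite addbF.
Qed.

(** * The classification *)

Lemma I_of_linear_clone C :
    clone C -> C `<=` L -> C (omega (xor2 false)) ->
  I_of C = [set C; C `&` Omega_eq].
Proof.
move=> Cc CL Cx; apply/seteqP; split=> [K [KI KC]|K [->|->]]; last 2 first.
- by split; [exact: I_all_clone | exact: clone_gen_id].
- by split; [exact: I_all_Omega_eq | exact: clone_gen_Omega_eq].
have KsC : K `<=` C by rewrite -KC; exact: sub_gen_smallest.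
have [Keq|] := pselect (K `<=` Omega_eq).
  right; apply/seteqP; split=> [f Kf|]; first by split; auto.
  rewrite -KC; apply: clone_gen_Omega_eq_sub => //; first exact: subset_trans CL.
  by rewrite KC.
move=> /existsNP [f /not_implyP [Kf fne]].
by left; rewrite -KC clone_gen_id //; exact: clone_of_not_Omega_eq KI Kf fne.
Qed.

Theorem theorem4p4 (C : set Omega) (hC : C = L \/ C = L0) :
  [/\ I_of C = [set C; C `&` Omega_eq],
      C <> C `&` Omega_eq
    & total_on (I_of C) (fun K1 K2 : set Omega => K1 `<=` K2)].
Proof.
have [Cc CL Cx] : [/\ clone C, C `<=` L & C (omega (xor2 false))].
  case: hC => ->; split=> //; first exact: L_clone.
  - by case: L0_xor2.
  - exact: L0_clone.
  - by move=> f [].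
  - exact: L0_xor2.
rewrite (I_of_linear_clone Cc CL Cx); split=> // [CE|].
  have := Cc.2 0 ord0; rewrite CE => -[_].
  by rewrite /Omega_eq /= !ffunE.
by move=> K1 K2 [->|->] [->|->]; [left|right|left|left] => // f [].
Qed.
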